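(* Let $(\mathcal{Y}_x)_{x\in\mathbb{N}}$ be a sequence of finite subsets of $\mathbb{Z}$ that is additively periodic with period length $p\in\mathbb{N}^+$ and has difference bounds $M^-<0<M^+$, and let $G$ be any Nim sequence over $(\mathcal{Y}_x)$. Then $G$ is additively periodic, and its period length $\tilde p$ satisfies $$\tilde p\le\binom{M}{\min(|M^-|,M^+)}\,p.$$
   Context: $\mathbb{N}=\{0,1,2,\dots\}$, $\mathbb{N}^+=\{1,2,\dots\}$. For a finite $Y\subseteq\mathbb{Z}$, $\operatorname{mex}(Y)=\min(\mathbb{N}\setminus Y)$. A sequence $(\mathcal{Y}_x)_{x\in\mathbb{N}}$ of finite subsets of $\mathbb{Z}$ is additively periodic with period length $p$ if $\mathcal{Y}_{x+p}=\mathcal{Y}_x+p$ for all $x\in\mathbb{N}$, $p$ being the least positive integer with this property. Its difference bounds are $M^+=\max\{z-x: x\in\mathbb{N}, z\in\mathcal{Y}_x\}+1$ and $M^-=\min\{z-x: x\in\mathbb{N}, z\in\mathcal{Y}_x\}-1$, and $M=|M^-|+M^+$. A Nim sequence over $(\mathcal{Y}_x)$ with seed $[g_0,\dots,g_{L-1}]$ ($L\in\mathbb{N}$, $g_i\in\mathbb{N}$ pairwise distinct) is $G:\mathbb{N}\to\mathbb{N}$ with $G(x)=g_x$ for $x<L$ and $G(x)=\operatorname{mex}(\{G(x'):x'<x\}\cup\mathcal{Y}_x)$ for $x\ge L$. $G$ is additively periodic if there are $\tilde P\in\mathbb{N}$, $\tilde p\in\mathbb{N}^+$ with $G(x+\tilde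 p)=G(x)+\tilde p$ for all $x\ge\tilde P$; the least such $\tilde p$ is the period length. *)

(* Defs.v *)
From HB Require Import structures.
From mathcomp Require Import all_boot all_order all_algebra finmap.

Set Implicit Arguments.
Unset Strict Implicit.
Unset Printing Implicit Defensive.

Import Order.TTheory GRing.Theory Num.Theory.

Local Open Scope fset_scope.
Local Open Scope ring_scope.

Lemma mex_subproof (A : {fset int}) : exists n : nat, n%:Z \notin A.
Proof.
exists (\max_(z <- enum_fset A) `|z|).+1%N; apply/negP => An.
have := @leq_bigmax_seq _ (enum_fset A) xpredT absz _ An isT.
by rewrite absz_nat ltnn.
Qed.

Definition mex (A : {fset int}) : nat := ex_minn (mex_subproof A).

Section SetSequence.
Variable Y : nat -> {fset int}.

Definition additive_period_sets (p : nat) : Prop :=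
  (0 < p)%N /\ forall x : nat, Y (x + p)%N = [fset z + p%:Z | z in Y x].

Definition period_length_sets (p : nat) : Prop :=
  additive_period_sets p /\
  forall q : nat, additive_period_sets q -> (p <= q)%N.

Definition difference (d : int) : Prop :=
  exists x : nat, exists2 z : int, z \in Y x & d = z - x%:Z.

(* The maximum (resp. minimum) is required to be attained, so these are
   satisfiable only if some [Y x] is nonempty. *)
Definition upper_difference_bound (Mp : int) : Prop :=
  exists2 d : int, difference d /\ (forall e, difference e -> e <= d)
                 & Mp = d + 1.

Definition lower_difference_bound (Mm : int) : Prop :=
  exists2 d : int, difference d /\ (forall e, difference e -> d <= e)
                 & Mm = d - 1.

Definition nim_sequence_with_seed (g : seq nat) (G : nat -> nat) : Prop :=
  [/\ uniq g,
      forall x : nat, (x < size g)%N -> G x = nth 0%N g x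
    & forall x : nat, (size g <= x)%N ->
        G x = mex ([fset (G x')%:Z | x' in iota 0 x] `|` Y x)].

Definition nim_sequence (G : nat -> nat) : Prop :=
  exists g : seq nat, nim_sequence_with_seed g G.

End SetSequence.

Section NatSequence.
Variable G : nat -> nat.

Definition additive_period (q : nat) : Prop :=
  (0 < q)%N /\
  exists P : nat, forall x : nat, (P <= x)%N -> G (x + q)%N = (G x + q)%N.

Definition additively_periodic : Prop := exists q : nat, additive_period q.

Definition period_length (q : nat) : Prop :=
  additive_period q /\ forall r : nat, additive_period r -> (q <= r)%N.

End NatSequence.

(* Main.v *)
(** Let [V x] be the set of values taken by [G] before time [x], [a = |M^-|] and
    [b = M^+].  Every set [[0, x - c)] with [c > a] that is contained in [V x]
    can be enlarged later on to [c - 1], and every bound [V x < x + c] with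
    [c > b] can be improved later on to [c - 1], both by counting: [V x] has
    exactly [x] elements.  Hence eventually [[0, x - a) <= V x < x + b], so that
    [V x] is encoded by a subset of cardinality [a] of a window of length
    [a + b].  This subset and the residue of [x] modulo [p] determine the future
    of [G] up to translation, and there are [C(a + b, a) * p] such states. *)

Require Import Defs.
From mathcomp Require Import all_boot all_order all_algebra finmap.
From mathcomp Require Import zify.
From Stdlib Require Import Classical.

Set Implicit Arguments.
Unset Strict Implicit.
Unset Printing Implicit Defensive.

Import GRing.Theory.

Local Open Scope ring_scope.

(** * Values taken before a given time *)

Section MexSequence.
Variables (Y : nat -> {fset int}) (G : nat -> nat).

Definition values_before (x : nat) : seq nat := [seq G i | i <- iota 0 x].

Local Notation V := values_before.

Lemma values_beforeP (x v : nat) :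
  reflect (exists2 i, (i < x)%N & v = G i) (v \in V x).
Proof.
apply: (iffP mapP) => [[i]|[i ix ->]]; last by exists i; rewrite ?mem_iota.
by rewrite mem_iota add0n => /= ix ->; exists i.
Qed.

Lemma size_values_before (x : nat) : size (V x) = x.
Proof. by rewrite size_map size_iota. Qed.

Lemma values_before_mono (x y v : nat) : (x <= y)%N -> v \in V x -> v \in V y.
Proof.
move=> xy /values_beforeP[i ix ->]; apply/values_beforeP; exists i => //.
exact: leq_trans xy.
Qed.

Lemma mem_values_beforeS (x v : nat) :
  (v \in V x.+1) = (v \in V x) || (v == G x).
Proof.
by rewrite /values_before -addn1 iotaD map_cat mem_cat /= inE add0n.
Qed.

Lemma mex_spec (A : {fset int}) :
  (mex A)%:Z \notin A /\ forall v : nat, v%:Z \notin A -> (mex A <= v)%N.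
Proof. by rewrite /mex; case: ex_minnP. Qed.

Lemma nim_step (g : seq nat) (x : nat) :
  nim_sequence_with_seed Y g G -> (size g <= x)%N ->
  [/\ G x \notin V x, (G x)%:Z \notin Y x
    & forall v : nat, v \notin V x -> v%:Z \notin Y x -> (G x <= v)%N].
Proof.
case=> _ _ Gmex gx; rewrite (Gmex x gx); set A := (X in mex X).
have memA (v : nat) : (v%:Z \in A) = (v \in V x) || (v%:Z \in Y x).
  rewrite /A in_fsetU; congr orb; apply/imfsetP/values_beforeP => /=.
    by case=> i; rewrite mem_iota => ix [->]; exists i.
  by case=> i ix ->; exists i => //; rewrite mem_iota.
have [] := mex_spec A; rewrite memA negb_or => /andP[mV mY] minA.
by split=> // v vV vY; apply: minA; rewrite memA negb_or vV.
Qed.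

Lemma nim_injective (g : seq nat) :
  nim_sequence_with_seed Y g G -> injective G.
Proof.
move=> nimG; have [g_uniq Gg _] := nimG.
have ltG i j : (i < j)%N -> G i != G j.
  move=> ij; have [jg|gj] := ltnP j (size g).
    by rewrite !Gg ?nth_uniq ?ltn_eqF // (ltn_trans ij).
  have [GjV _ _] := nim_step nimG gj; apply: contraNneq GjV => <-.
  by apply/values_beforeP; exists i.
by move=> i j Gij; case: (ltngtP i j) => // /ltG; rewrite Gij eqxx.
Qed.

End MexSequence.

Lemma additive_period_setsM (Y : nat -> {fset int}) (p k x : nat) (z : int) :
  additive_period_sets Y p ->
  (z + (k * p)%N%:Z \in Y (x + k * p)%N) = (z \in Y x).
Proof.
case=> _ Yp; elim: k => [|k IHk]; first by rewrite mul0n addn0 addr0.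
rewrite mulSnr addnA Yp PoszD addrA -IHk; apply/imfsetP/idP => /=.
  by case=> w wY /addIr ->.
by move=> zY; exists (z + (k * p)%N%:Z).
Qed.

(** * Eventual confinement of the values *)

Section Windows.
Variables (Y : nat -> {fset int}) (g : seq nat) (G : nat -> nat) (a b : nat).
Hypothesis nimG : nim_sequence_with_seed Y g G.
Hypothesis Ybound : forall x z, z \in Y x -> - a%:Z < z - x%:Z < b%:Z.

Local Notation V := (values_before G).

Lemma uniq_values_before (x : nat) : uniq (V x).
Proof. by rewrite map_inj_uniq ?iota_uniq //; apply: nim_injective nimG. Qed.

(** The additive form avoids truncated subtraction; for [x <= c] the condition is vacuous. *)
Definition filled_below (c x : nat) := forall v : nat, (v + c < x)%N -> v \in V x.
Definition bounded_above (c x : nat) := forall v : nat, v \in V x -> (v < x + c)%N.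

(** Only [v = x - c] is new. As [v - x <= -a], it is not in [Y x], so if it is still free then
    [G x <= v]; all smaller values are taken, hence [G x = v]. *)
Lemma filled_below_next (c x : nat) : (size g <= x)%N -> (a <= c)%N ->
  filled_below c x -> filled_below c x.+1.
Proof.
move=> gx ac fx v vx; rewrite mem_values_beforeS.
have [_ _ Gmin] := nim_step nimG gx; have [GV _ _] := nim_step nimG gx.
have [vV|vV] /= := boolP (v \in V x); first by [].
have vcx : (v + c)%N = x.
  by apply/eqP; rewrite eqn_leq -ltnS vx leqNgt; apply: contraNN vV => /fx.
have Gv : (G x <= v)%N.
  by apply: Gmin => //; apply/negP => /Ybound; lia.
rewrite eqn_leq Gv andbT leqNgt; apply: contraNN GV => Gltv; apply: fx; lia.
Qed.

Lemma filled_below_later (c x y : nat) : (size g <= x)%N -> (a <= c)%N ->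
  (x <= y)%N -> filled_below c x -> filled_below c y.
Proof.
move=> gx ac /subnKC <-; elim: (y - x)%N => [|k IHk] fx; first by rewrite addn0.
by rewrite addnS; apply: filled_below_next (IHk fx) => //; lia.
Qed.

(** The [x] distinct values in [V x] cannot all lie below [x - c.+1], so some [w] in [V x] is at
    least that large. At time [w + c.+1] all values below [w] are taken, and [w] was taken in
    advance, which gains one. *)
Lemma filled_below_improve (c x : nat) : (size g <= x)%N -> (0 < x)%N ->
  (a <= c)%N -> filled_below c.+1 x -> exists2 y, (x <= y)%N & filled_below c y.
Proof.
move=> gx x0 ac fx.
have /hasP[w wV xw] : has (fun w => x <= w + c.+1)%N (V x).
  apply/negPn; rewrite -all_predC; apply/negP => /allP small.
  have sub : {subset V x <= iota 0 (x - c.+1)}.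
    by move=> w /small /=; rewrite mem_iota; lia.
  have := uniq_leq_size (uniq_values_before x) sub.
  rewrite size_values_before size_iota; lia.
exists (w + c.+1)%N => // v vw.
have wV' := values_before_mono xw wV.
have [->//|vw'] := eqVneq v w.
by apply: (@filled_below_later c.+1 x) => //; lia.
Qed.

Lemma filled_below_eventually : exists2 x, (size g <= x)%N & filled_below a x.
Proof.
(* This holds vacuously. The time is [(size g).+1] because the counting needs [0 < x]. *)
have start : filled_below (size g).+1 (size g).+1 by move=> v; lia.
suff: forall k x, (size g < x)%N -> filled_below (a + k) x ->
    exists2 y, (size g <= y)%N & filled_below a y.
  move/(_ (size g).+1 _ (ltnSn _)); apply => v; lia.
elim=> [|k IHk] x gx; first by rewrite addn0 => fx; exists x => //; apply: ltnW.
rewrite addnS => /filled_below_improve[]; [lia|lia|lia|].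
by move=> y xy; apply: IHk; lia.
Qed.

(** The value [x + c] is neither in [V x] nor, since [b <= c], in [Y x], so the mex cannot exceed
    it. *)
Lemma bounded_above_next (c x : nat) : (size g <= x)%N -> (b <= c)%N ->
  bounded_above c x -> bounded_above c x.+1.
Proof.
move=> gx bc ux v; rewrite mem_values_beforeS => /orP[/ux|/eqP->]; first lia.
have [_ _ Gmin] := nim_step nimG gx.
have: (G x <= x + c)%N; last by lia.
by apply: Gmin; apply/negP; [move/ux|move/Ybound]; lia.
Qed.

Lemma bounded_above_later (c x y : nat) : (size g <= x)%N -> (b <= c)%N ->
  (x <= y)%N -> bounded_above c x -> bounded_above c y.
Proof.
move=> gx bc /subnKC <-; elim: (y - x)%N => [|k IHk] ux; first by rewrite addn0.
by rewrite addnS; apply: bounded_above_next (IHk ux) => //; lia.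
Qed.

Lemma bounded_above_improve (c x : nat) : (size g <= x)%N ->
  (b <= c)%N -> bounded_above c.+1 x ->
  exists2 y, (x <= y)%N & bounded_above c y.
Proof.
move=> gx bc ux.
(* At time [y] the old bound is [y + c.+1], which equals [y.+1 + c]; so it improves as soon as the
   new value [G y] also respects it. *)
suff [y xy Gy] : exists2 y, (x <= y)%N & (G y < y + c.+1)%N.
  exists y.+1; first exact: leqW.
  move=> v; rewrite mem_values_beforeS => /orP[|/eqP->]; last lia.
  by move/(bounded_above_later gx (leqW bc) xy ux); lia.
have /hasP[w] : has (fun w => w \notin V x) (iota 0 (x + c.+1)).
  apply/negPn; rewrite -all_predC; apply/negP => /allP full.
  have sub : {subset iota 0 (x + c.+1) <= V x}.
    by move=> w /full /=; rewrite negbK.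
  have := uniq_leq_size (iota_uniq _ _) sub.
  rewrite size_values_before size_iota; lia.
(* From time [w + a] on, [w] is too low to belong to [Y y]. Hence [w] is taken at some time in
   [[x, y)], or else [G y <= w]; either gives a small value. *)
rewrite mem_iota => wx wV; pose y := maxn x (w + a).
have [/values_beforeP[i _ wG]|wVy] := boolP (w \in V y).
  have [ix|xi] := ltnP i x; last by exists i => //; lia.
  by case/negP: wV; apply/values_beforeP; exists i.
have gy : (size g <= y)%N by rewrite /y; lia.
have [_ _ Gmin] := nim_step nimG gy.
exists y; first by rewrite /y; lia.
have: (G y <= w)%N; last by rewrite /y; lia.
by apply: Gmin => //; apply/negP => /Ybound; rewrite /y; lia.
Qed.

Lemma bounded_above_eventually : exists2 x, (size g <= x)%N & bounded_above b x.
Proof.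
have start : bounded_above (\max_(v <- V (size g)) v).+1 (size g).
  move=> v vV; apply: leq_trans (leq_addl _ _); rewrite ltnS.
  exact: (@leq_bigmax_seq _ _ xpredT id v vV isT).
suff: forall k x, (size g <= x)%N -> bounded_above (b + k) x ->
    exists2 y, (size g <= y)%N & bounded_above b y.
  move/(_ (\max_(v <- V (size g)) v).+1 _ (leqnn _)); apply => v /start; lia.
elim=> [|k IHk] x gx; first by rewrite addn0 => ux; exists x.
rewrite addnS => /bounded_above_improve[]; [lia|lia|].
by move=> y xy; apply: IHk; lia.
Qed.

(** * Recurrence of states *)

Lemma nim_shift (q x : nat) : (size g <= x)%N ->
  (forall y z, (z + q%:Z \in Y (y + q)%N) = (z \in Y y)) ->
  (forall v, (v \in V (x + q)%N) = (v < q)%N || (v - q \in V x)%N) ->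
  forall y, (x <= y)%N -> G (y + q)%N = (G y + q)%N.
Proof.
move=> gx Yq Vq y xy.
(* The values forbidden at [y' + q] are those forbidden at [y'] translated by [q], together with
   everything below [q]; so the mex moves by exactly [q]. *)
have G_of_V y' : (x <= y')%N ->
    (forall v, (v \in V (y' + q)%N) = (v < q)%N || (v - q \in V y')%N) ->
    G (y' + q)%N = (G y' + q)%N.
  move=> xy' Vq'; have gy : (size g <= y')%N by lia.
  have [GV GY Gmin] := nim_step nimG gy.
  have [|GqV GqY Gqmin] := nim_step (x := (y' + q)%N) nimG; first by lia.
  move: GqV; rewrite Vq' negb_or -leqNgt => /andP[qG GqV].
  apply/eqP; rewrite eqn_leq; apply/andP; split.
    apply: Gqmin; last by rewrite PoszD Yq.
    by rewrite Vq' negb_or addnK GV andbT; lia.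
  have: (G y' <= G (y' + q) - q)%N; last by lia.
  by apply: Gmin => //; rewrite -Yq -PoszD subnK.
apply: (G_of_V y) => //; move: xy => /subnKC <-.
elim: (y - x)%N => [|k IHk] v; first by rewrite addn0.
rewrite addnS addSn !mem_values_beforeS IHk (G_of_V _ _ IHk) ?leq_addr //.
lia.
Qed.

Definition window (x : nat) : {set 'I_(a + b)} :=
  [set i : 'I_(a + b) | x - a + i \in V x]%N.

(** The [x] distinct values in [V x] are the [x - a] values below [x - a] and those recorded by the
    window. *)
Lemma card_window (x : nat) : (a <= x)%N ->
  filled_below a x -> bounded_above b x -> #|window x| = a.
Proof.
move=> ax fx ux.
pose s := (iota 0 (x - a) ++ [seq (x - a + i)%N | i : 'I_(a + b) in window x])%N.
have s_uniq : uniq s.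
  rewrite cat_uniq iota_uniq map_inj_uniq ?enum_uniq ?andbT /=; last first.
    by move=> i j /addnI /val_inj.
  by apply/hasPn => _ /mapP[i _ ->]; rewrite mem_iota; lia.
have sV : s =i V x.
  move=> v; rewrite mem_cat mem_iota /= add0n.
  have [vx|xv] /= := ltnP v (x - a); first by rewrite fx //; lia.
  apply/mapP/idP => [[i]|vV]; first by rewrite mem_enum inE => iV ->.
  have := ux v vV => vb.
  have lt_i : (v - (x - a) < a + b)%N by lia.
  exists (Ordinal lt_i); last by rewrite /=; lia.
  by rewrite mem_enum inE /= subnKC.
have := perm_size (uniq_perm s_uniq (uniq_values_before x) sV).
rewrite size_cat size_iota size_image size_values_before => cardW.
by apply: (@addnI (x - a)%N); rewrite cardW subnK.
Qed.

Lemma window_shift (x q : nat) : (a <= x)%N ->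
  filled_below a x -> filled_below a (x + q)%N ->
  bounded_above b x -> bounded_above b (x + q)%N ->
  window x = window (x + q)%N ->
  forall v, (v \in V (x + q)%N) = (v < q)%N || (v - q \in V x)%N.
Proof.
move=> ax fx fq ux uq /setP Wq v.
have [vq|qv] /= := ltnP v q; first by apply: fq; lia.
have [vx|xv] := ltnP v (x + q - a); first by rewrite fq ?fx //; lia.
have [vb|bv] := ltnP v (x + q + b); last first.
  by apply/idP/idP => [/uq|/ux]; lia.
have lt_i : (v - (x + q - a) < a + b)%N by lia.
have := Wq (Ordinal lt_i); rewrite !inE /=.
have -> : (x - a + (v - (x + q - a)) = v - q)%N by lia.
by rewrite subnKC.
Qed.

Lemma nim_additive_period (p : nat) : additive_period_sets Y p ->
  exists2 q, additive_period G q & (q <= 'C(a + b, a) * p)%N.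
Proof.
move=> Yp; have [p_gt0 _] := Yp.
have [x1 gx1 fx1] := filled_below_eventually.
have [x2 gx2 ux2] := bounded_above_eventually.
pose N := maxn a (maxn x1 x2).
have fN x : (N <= x)%N -> filled_below a x.
  by move=> Nx; apply: (filled_below_later gx1 _ _ fx1) => //; lia.
have uN x : (N <= x)%N -> bounded_above b x.
  by move=> Nx; apply: (bounded_above_later gx2 _ _ ux2) => //; lia.
(* There is one more index than there are pairs of an [a]-subset and a residue, so two states
   coincide. *)
pose state (k : 'I_('C(a + b, a) * p).+1) : {set 'I_(a + b)} * 'I_p :=
  (window (N + k)%N, Ordinal (ltn_pmod (N + k) p_gt0)).
have /injectivePn[k [l kl eq_kl]] : ~~ injectiveb state.
  apply/negP => /injectiveP state_inj.
  pose S := setX [set A : {set 'I_(a + b)} | #|A| == a] [set: 'I_p].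
  have sub : state @: setT \subset S.
    apply/subsetP => _ /imsetP[k _ ->]; rewrite in_setX inE in_setT andbT.
    by rewrite card_window ?eqxx //; [lia|apply: fN; lia|apply: uN; lia].
  have := subset_leq_card sub; rewrite card_imset // !cardsX card_draws.
  by rewrite !cardsT !card_ord ltnn.
wlog lt_kl : k l kl eq_kl / (k < l)%N.
  move=> base; case: (ltngtP k l) => [| |/val_inj klE]; first exact: base.
    by apply: base; rewrite // eq_sym.
  by rewrite klE eqxx in kl.
case: eq_kl => Wkl mod_kl; pose q := (l - k)%N.
have lE : (N + l = N + k + q)%N by rewrite /q; lia.
(* Equal residues make [q] a multiple of [p], so that [Y] is invariant under translation by [q]. *)
have /dvdnP[m qE] : (p %| q)%N.
  by rewrite /q -(subnDl N) -eqn_mod_dvd ?mod_kl //; lia.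
exists q; last by have := ltn_ord l; rewrite /q; lia.
split; first by rewrite /q subn_gt0.
exists (N + k)%N; apply: nim_shift; first by rewrite /N; lia.
  by move=> y z; rewrite qE additive_period_setsM.
apply: window_shift; rewrite -?lE //; try (apply: fN || apply: uN); lia.
Qed.

End Windows.

(** Excluded middle replaces decidability, since [additive_period G] quantifies over all times. *)
Lemma least_nat (P : nat -> Prop) (n : nat) : P n ->
  exists2 m, P m & forall k, P k -> (m <= k)%N.
Proof.
elim/ltn_ind: n => n IHn Pn.
have [[k kn Pk]|none] := classic (exists2 k, (k < n)%N & P k).
  exact: IHn kn Pk.
exists n => // k Pk; rewrite leqNgt; apply/negP => kn.
by apply: none; exists k.
Qed.

Theorem theoremt (Y : nat -> {fset int}) (p : nat) (Mm Mp : int)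
    (G : nat -> nat) :
  period_length_sets Y p ->
  lower_difference_bound Y Mm ->
  upper_difference_bound Y Mp ->
  Mm < 0 -> 0 < Mp ->
  nim_sequence Y G ->
  additively_periodic G /\
  exists q : nat,
    period_length G q /\
    (q <= 'C(`|Mm| + `|Mp|, minn `|Mm| `|Mp|) * p)%N.
Proof.
move=> [Yp _] [dm [_ dm_min] MmE] [dp [_ dp_max] MpE] Mm_lt0 Mp_gt0 [g nimG].
have Ybound x z : z \in Y x -> - `|Mm|%N%:Z < z - x%:Z < `|Mp|%N%:Z.
  move=> zY; have dz : difference Y (z - x%:Z) by exists x, z.
  have := dm_min _ dz; have := dp_max _ dz; lia.
have [q Gq q_le] := nim_additive_period nimG Ybound Yp.
have [r Gr r_min] := least_nat Gq.
split; first by exists q.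
exists r; split; first by [].
apply: leq_trans (r_min q Gq) _; apply: leq_trans q_le _; rewrite leq_mul2r.
(* If [|Mp|] is the smaller one, the symmetry of binomial coefficients applies. *)
apply/orP; right; have [_|_] := leqP `|Mm| `|Mp|; first by [].
by rewrite -bin_sub ?leq_addr // addKn.
Qed.
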